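(* Suppose $\phi_0 \in \mathfrak{K}(a,b,\kappa_1,\kappa_2)$. Then there exist positive constants $c$, $\epsilon_0$ and $\epsilon_1$ depending only on $\kappa_1$, $\kappa_2$, $b-a$ and $c_2$ such that $$\log M(\epsilon, S(\phi_0,r),\ell) \geq c\,\epsilon^{-1/2} \qquad \text{for } \epsilon_1 n^{-2} \leq \epsilon \leq r\epsilon_0.$$
   Context: Let $\mathcal{C}$ denote the set of all real-valued convex functions on $[0,1]$. Let $n \ge 2$ and let $x_1 < x_2 < \dots < x_n$ be fixed design points in $[0,1]$ satisfying $c_1 \le n(x_i - x_{i-1}) \le c_2$ for $i = 2, \dots, n$, where $c_1, c_2$ are positive constants. For a subinterval $[a,b]$ of $[0,1]$ and positive real numbers $\kappa_1<\kappa_2$, $\mathfrak{K}(a,b,\kappa_1,\kappa_2)$ is the class of all convex functions $\phi$ on $[0,1]$ which are twice differentiable on $[a,b]$ and satisfy $\kappa_1\le\phi''(x)\le\kappa_2$ for all $x\in[a,b]$. For real functions $\phi,\psi$ on $[0,1]$, $\ell^2(\phi,\psi) := \frac1n\sum_{i=1}^n(\phi(x_i)-\psi(x_i))^2$, and $\ell$ (a pseudometric) is its nonnegative square root. For $r>0$, $S(\phi_0,r) := \{\phi\in\mathcal{C} : \ell^2(\phi,\phi_0)\le r^2\}$. For a subset $\mathcal{F}$ of a (pseudo)metric space $(\mathcal{X},\rho)$, the covering number $M(\epsilon,\mathcal{F},\rho)$ is the smallest number of closed balls of radius $\epsilon$ whose union contains $\mathcal{F}$.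
   Formalization: Added hypothesis: n(x_1 − a) ≤ c_2 and n(b − x_n) ≤ c_2, so the design points reach both ends of [a,b] up to the spacing bound; without it all design points may lie off [a,b] and the claim fails. *)

(* Defs.v *)
From HB Require Import structures.
From mathcomp Require Import all_boot all_order all_algebra.
From mathcomp Require Import all_classical all_reals all_analysis.

Set Implicit Arguments.
Unset Strict Implicit.
Unset Printing Implicit Defensive.

Import Order.TTheory GRing.Theory Num.Theory.
Import numFieldNormedType.Exports.

Local Open Scope classical_set_scope.
Local Open Scope ring_scope.

(* Functions on [0, 1] are represented by total functions [R -> R] of which
   only the values on [0, 1] are ever used. *)

Definition convex01 (R : realType) : set (R -> R) :=
  [set phi | convex_function (`[0, 1]%classic : set R) phi].

(* The difference quotient is restricted to D, so that derivatives are
   one-sided at the endpoints when D is a closed interval; this avoids any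
   dependence on the values of f outside D. *)
Definition has_deriv_within (R : realType) (D : set R) (f : R -> R)
    (x l : R) : Prop :=
  (fun y => (f y - f x) / (y - x)) @ within D x^' --> l.

Definition curved (R : realType) (a b k1 k2 : R) : set (R -> R) :=
  [set phi | convex01 phi /\
    exists phi1 phi2 : R -> R,
      forall x, a <= x <= b ->
        [/\ has_deriv_within `[a, b] phi x (phi1 x),
            has_deriv_within `[a, b] phi1 x (phi2 x) &
            k1 <= phi2 x <= k2]].

(* Indices are shifted: [x i] with [i : 'I_n] is the (i+1)-st design point. *)
Definition design (R : realType) (n : nat) (c1 c2 : R) (x : 'I_n -> R) : Prop :=
  [/\ forall i, 0 <= x i <= 1,
      forall i j : 'I_n, (i < j)%N -> x i < x j &
      forall i j : 'I_n, j = i.+1 :> nat -> c1 <= n%:R * (x j - x i) <= c2].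

(* The spacing bound of [design] constrains only consecutive design points, so
   it does not prevent all of them from lying away from [a, b] (where the values
   of a function on [a, b] are then invisible to the empirical metric).  Here
   the bound c2 / n is also imposed on the portion of [a, b] that precedes the
   first design point and on the one that follows the last design point. *)
Definition design_reaches (R : realType) (n : nat) (c2 : R) (x : 'I_n -> R)
    (a b : R) : Prop :=
  forall i : 'I_n,
    (i = 0%N :> nat -> n%:R * (x i - a) <= c2) /\
    (i.+1 = n -> n%:R * (b - x i) <= c2).

Definition ell2 (R : realType) (n : nat) (x : 'I_n -> R)
    (phi psi : R -> R) : R :=
  n%:R^-1 * \sum_(i < n) (phi (x i) - psi (x i)) ^+ 2.

Definition ell (R : realType) (n : nat) (x : 'I_n -> R)
    (phi psi : R -> R) : R :=
  Num.sqrt (ell2 x phi psi).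

Definition convex_ball (R : realType) (n : nat) (x : 'I_n -> R)
    (phi0 : R -> R) (r : R) : set (R -> R) :=
  [set phi | convex01 phi /\ ell2 x phi phi0 <= r ^+ 2].

(* Centres range over the whole space X, not only over F. *)
Definition coverable (R : realType) (X : Type) (rho : X -> X -> R) (e : R)
    (F : set X) (N : nat) : Prop :=
  exists z : 'I_N -> X, F `<=` \bigcup_(k in [set: 'I_N]) [set y | rho y (z k) <= e].

(* +oo when no finite number of balls covers F. *)
Definition covering_number (R : realType) (X : Type) (e : R) (F : set X)
    (rho : X -> X -> R) : \bar R :=
  ereal_inf [set (N%:R%:E)%E | N in coverable rho e F].

(* Main.v *)
Require Import Defs.
From HB Require Import structures.
From mathcomp Require Import all_boot all_order all_algebra.
From mathcomp Require Import all_classical all_reals all_analysis.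
From mathcomp Require Import ring lra zify.

Set Implicit Arguments.
Unset Strict Implicit.
Unset Printing Implicit Defensive.

Import Order.TTheory GRing.Theory Num.Theory.
Import numFieldNormedType.Exports.

Local Open Scope classical_set_scope.
Local Open Scope ring_scope.

(** On an interval of length [eta] where [f] has curvature between [k1] and [k2],
    replacing [f] by its chord raises it by an amount of exact order [eta ^+ 2]
    ([interpolation_error], [chord_bounds]), and the result is again convex.
    Cutting [a, b] into [k] intervals of length [eta = L / k] and replacing [f]
    by its chord on an arbitrary subcollection of them gives [2 ^ k] convex
    functions indexed by the subsets of the set of intervals ([chorded]).  All of
    them stay within order [eta ^+ 2] of [f] ([ell2_chorded_le]), hence in the
    ball of radius [r].

    Since consecutive design points are at most [c2 / n] apart and reach both
    ends of [a, b], the middle half of each interval holds a number of design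
    points of order [n * eta] as soon as [eta] is large compared with [c2 / n]
    ([design_count]).  So every interval treated differently for two subsets
    contributes order [eta ^+ 5] to their squared distance ([ell2_chorded_ge]),
    and two subsets differing on a fixed fraction of the [k = L / eta] intervals
    are at distance at least of order [eta ^+ 2].  With [eta] a large multiple of
    the square root of [eps], a ball of radius [eps] therefore only sees subsets
    that pairwise differ on at most [k / 8] intervals.  Such a family is an
    exponentially small part of the cube of all subsets ([card_cube_le]), so the
    number of balls is exponential in [k], that is, in [eps `^ (- 2^-1)].

    This requires at least eight intervals, hence [eps] below a constant.  For
    larger [eps] the claimed bound is itself below [ln 2], and it is enough that
    one ball of radius [eps < r] cannot contain both [f + r] and [f - r]
    ([covering_ge2]). *)

(** * One-sided derivatives on a closed interval *)

Lemma has_deriv_within_continuous (R : realType) (D : set R) (f : R -> R)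
    (x l : R) :
  has_deriv_within D f x l -> f y @[y --> within D (nbhs x)] --> f x.
Proof.
move=> fl.
have idx : (fun y => y - x) @ within D x^' --> (0 : R).
  rewrite -[X in _ --> X](subrr x); apply: cvgB; last exact: cvg_cst.
  by move=> U xU; apply: cvg_within; exact: nbhs_dnbhs.
have dcvg : f @ within D x^' --> f x.
  have lim : (fun y => f x + (f y - f x) / (y - x) * (y - x)) @ within D x^'
      --> f x + l * 0 by apply: cvgD; [exact: cvg_cst | exact: cvgM].
  rewrite mulr0 addr0 in lim; apply: cvg_trans lim; apply: near_eq_cvg.
  rewrite near_withinE; apply: filterS (nbhs_dnbhs_neq x) => y yx _ /=.
  by rewrite divfK ?subrKC// subr_eq0.
move=> U fxU.
have dU : \forall y \near x, y != x -> D y -> U (f y) by exact: dcvg U fxU.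
suff: \forall y \near x, D y -> U (f y) by [].
apply: filterS dU => y; have [->|yx] := eqVneq y x; last exact.
by move=> _ _; exact: nbhs_singleton.
Qed.

Lemma has_deriv_within_is_derive (R : realType) (a b : R) (f : R -> R)
    (x l : R) :
  x \in `]a, b[ -> has_deriv_within `[a, b] f x l -> is_derive x 1 f l.
Proof.
move=> xab fl; apply/is_derive1_caratheodory.
exists (fun y => if y == x then l else (f y - f x) / (y - x)); split => [y||].
- by have [->|yx] := eqVneq y x; rewrite ?subrr ?mulr0// divfK// subr_eq0.
- rewrite /prop_for /continuous_at eqxx => U lU.
  have dU : \forall y \near x, y != x -> `[a, b]%classic y ->
      U ((f y - f x) / (y - x)) by exact: fl U lU.
  suff : \forall y \near x, U (if y == x then l else (f y - f x) / (y - x)).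
    by [].
  apply: filterS2 (near_in_itvoo xab) dU => y yab.
  have [_ _|yx] := eqVneq y x; first exact: nbhs_singleton.
  by apply => //; exact: subset_itv_oo_cc yab.
- by rewrite eqxx.
Qed.

(** * Chords and the interpolation error *)

Definition chord (R : realType) (f : R -> R) (u v t : R) : R :=
  f u + (f v - f u) / (v - u) * (t - u).

(** The constant [K] below makes the error minus [K (s - u) (v - s)] vanish at
    [u], [t] and [v]; applying Rolle twice, its second derivative vanishes
    somewhere, which identifies [K]. *)
Lemma interpolation_error (R : realType) (a b : R) (f f1 f2 : R -> R)
    (u v t : R) :
  (forall x, a <= x <= b ->
     has_deriv_within `[a, b] f x (f1 x) /\
     has_deriv_within `[a, b] f1 x (f2 x)) ->
  a <= u -> u < t -> t < v -> v <= b ->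
  exists2 xi, a <= xi <= b &
    chord f u v t - f t = f2 xi / 2 * ((t - u) * (v - t)).
Proof.
move=> df au ut tv vb.
have fcont : {within `[a, b], continuous f}.
  apply/subspace_continuousP => x xab.
  exact: has_deriv_within_continuous (df x xab).1.
pose K := (chord f u v t - f t) / ((t - u) * (v - t)).
pose p := (f v - f u) / (v - u).
pose P s := f u + p * (s - u) - K * ((s - u) * (v - s)).
pose F s := f s - P s.
pose G s := f1 s - (p - K * (u + v - 2 * s)).
have dP (s : R) : is_derive s 1 P (p - K * (u + v - 2 * s)).
  apply/is_derive1_caratheodory; exists (fun z => p - K * (u + v - (z + s))).
  split; [by move=> z; rewrite /P; ring | | by ring].
  apply: cvgB; first exact: cvg_cst.
  apply: cvgM; first exact: cvg_cst.
  apply: cvgB; first exact: cvg_cst.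
  by apply: cvgD; [exact: cvg_id | exact: cvg_cst].
have dF (s : R) : s \in `]a, b[ -> is_derive s 1 F (G s).
  move=> sab; apply: is_deriveB.
  apply: (has_deriv_within_is_derive sab).
  by apply: (df s _).1; exact: subset_itv_oo_cc sab.
have dG (s : R) : s \in `]a, b[ -> is_derive s 1 G (f2 s - 2 * K).
  move=> sab; apply: is_deriveB.
    apply: (has_deriv_within_is_derive sab).
    by apply: (df s _).2; exact: subset_itv_oo_cc sab.
  apply/is_derive1_caratheodory; exists (fun=> 2 * K).
  by split=> //; [move=> z; ring | exact: cvg_cst].
have Fcont : {within `[a, b], continuous F}.
  move=> s. 
  apply: continuousB. exact: fcont. 
  apply: continuous_subspaceT => y.
  by apply/differentiable_continuous/derivable1_diffP; exact: ex_derive.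
have Fzero c d : a <= c -> c < d -> d <= b -> F c = 0 -> F d = 0 ->
    exists2 e, c < e < d & G e = 0.
  move=> ac cd db Fc Fd.
  have sub s : s \in `]c, d[ -> s \in `]a, b[ by exact: subset_itvW.
  have [||e ecd de] := @Rolle _ F c d cd _ _ (etrans Fc (esym Fd)).
  - by move=> s /sub/dF ds; exact: ex_derive.
  - by apply: continuous_subspaceW Fcont; apply: subset_itvScc; rewrite bnd_simp.
  exists e; first by rewrite in_itv in ecd.
  by rewrite -(@derive_val _ _ _ _ _ _ _ (dF _ (sub _ ecd))) derive_val.
have Fu : F u = 0 by rewrite /F /P; ring.
have Fv : F v = 0.
  rewrite /F /P /p. field. by rewrite subr_eq0 gt_eqF ?(lt_trans ut).
have Ft : F t = 0.
  rewrite /F /P /K /chord -/p. field. by rewrite !subr_eq0 !gt_eqF.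
have [c1 /andP[uc1 c1t] Gc1] := Fzero u t au ut (ltW (lt_le_trans tv vb)) Fu Ft.
have [c2 /andP[tc2 c2v] Gc2] := Fzero t v (ltW (le_lt_trans au ut)) tv vb Ft Fv.
(* The zeros [c1], [c2] of [G] are interior to [[a, b]], where the one-sided
   derivatives of [f1] are genuine ones. *)
have c12 := lt_trans c1t tc2.
have sub s : c1 <= s <= c2 -> s \in `]a, b[.
  by move=> /andP[? ?]; rewrite in_itv/=; apply/andP; split; lra.
have [||e ec de] := @Rolle _ G c1 c2 c12 _ _ (etrans Gc1 (esym Gc2)).
- by move=> s /subset_itv_oo_cc/sub/dG ds; exact: ex_derive.
- apply: derivable_within_continuous => s /sub/dG ds; exact: ex_derive.
have eab := sub _ (subset_itv_oo_cc ec).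
exists e; first exact: subset_itv_oo_cc eab.
have : f2 e - 2 * K = 0.
  by rewrite -(@derive_val _ _ _ _ _ _ _ (dG _ eab)) derive_val.
move=> /eqP; rewrite subr_eq0 => /eqP ->.
rewrite /K. field. by rewrite !subr_eq0 !gt_eqF.
Qed.

Lemma chord_bounds (R : realType) (a b k1 k2 : R) (f : R -> R) (u v t : R) :
  f \in curved a b k1 k2 -> a <= u -> u < v -> v <= b -> u <= t <= v ->
  k1 / 2 * ((t - u) * (v - t)) <= chord f u v t - f t
    <= k2 / 2 * ((t - u) * (v - t)).
Proof.
rewrite inE => -[_ [f1 [f2 df]]] au uv vb /andP[].
rewrite le_eqVlt => /predU1P[<- _|ut].
  by rewrite /chord subrr mul0r !mulr0 addr0 subrr lexx.
rewrite le_eqVlt => /predU1P[->|tv].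
  by rewrite /chord divfK ?subr_eq0 ?gt_eqF// subrKC !subrr !mulr0 lexx.
have [x xab|xi xiab ->] := @interpolation_error _ a b f f1 f2 _ _ _ _ au ut tv vb.
  by have [] := df x xab.
have [_ _ /andP[k1f fk2]] := df _ xiab.
have w0 : 0 <= (t - u) * (v - t) by apply: mulr_ge0; lra.
by apply/andP; split; apply: ler_wpM2r => //; lra.
Qed.

Lemma convex01P (R : realType) (f : R -> R) :
  convex01 f <-> forall p x y, 0 <= p <= 1 -> 0 <= x <= 1 -> 0 <= y <= 1 ->
    f (p * x + (1 - p) * y) <= p * f x + (1 - p) * f y.
Proof.
split=> [fc p x y /andP[p0 p1] x01 y01|fc p x y /set_mem/= x01 /set_mem/= y01].
  have := fc (Itv01 p0 p1) x y; rewrite !inE !convRE/=; apply=> //.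
rewrite !convRE; apply: fc => //; apply/andP; split=> //; exact: ge0.
Qed.

(** The node on the side of [t] separates [t] from the other node, so it is a
    convex combination of those two; the convexity inequality there, solved for
    [f t], is the claim. *)
Lemma chord_le_outside (R : realType) (f : R -> R) (u v t : R) :
  convex01 f -> 0 <= u -> u < v -> v <= 1 -> 0 <= t <= 1 -> t <= u \/ v <= t ->
  chord f u v t <= f t.
Proof.
move=> /convex01P fc u0 uv v1 /andP[t0 t1] [tu|vt].
- have d0 : 0 < v - t by lra.
  have d1 : 0 < v - u by lra.
  have p01 : 0 <= (v - u) / (v - t) <= 1.
    by rewrite divr_ge0 ?ler_pdivrMr//=; lra.
  have := fc _ t v p01; set p := _ / _; have p0 : 0 < p by rewrite divr_gt0.
  have -> : p * t + (1 - p) * v = u by rewrite /p; field; rewrite gt_eqF.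
  move=> fu; rewrite -subr_le0.
  have -> : chord f u v t - f t = (f u - (p * f t + (1 - p) * f v)) / p.
    by rewrite /chord /p; field; rewrite !gt_eqF.
  by rewrite pmulr_lle0 ?invr_gt0// subr_le0 fu //; lra.
- have d0 : 0 < t - u by lra.
  have d1 : 0 < v - u by lra.
  have p01 : 0 <= (v - u) / (t - u) <= 1.
    by rewrite divr_ge0 ?ler_pdivrMr//=; lra.
  have := fc _ t u p01; set p := _ / _; have p0 : 0 < p by rewrite divr_gt0.
  have -> : p * t + (1 - p) * u = v by rewrite /p; field; rewrite gt_eqF.
  move=> fu; rewrite -subr_le0.
  have -> : chord f u v t - f t = (f v - (p * f t + (1 - p) * f u)) / p.
    by rewrite /chord /p; field; rewrite !gt_eqF.
  by rewrite pmulr_lle0 ?invr_gt0// subr_le0 fu //; lra.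
Qed.

Lemma chord_ge_inside (R : realType) (f : R -> R) (u v t : R) :
  convex01 f -> 0 <= u -> u < v -> v <= 1 -> u <= t <= v ->
  f t <= chord f u v t.
Proof.
move=> /convex01P fc u0 uv v1 /andP[ut tv].
have d : 0 < v - u by lra.
have p01 : 0 <= (v - t) / (v - u) <= 1.
  by rewrite divr_ge0 ?ler_pdivrMr//=; lra.
have := fc _ u v p01; set p := _ / _.
have -> : p * u + (1 - p) * v = t by rewrite /p; field; rewrite gt_eqF.
have -> : p * f u + (1 - p) * f v = chord f u v t.
  by rewrite /chord /p; field; rewrite gt_eqF.
by apply; lra.
Qed.

(** Written as a maximum, rather than by cases on the position of [t], so that
    convexity is immediate.  For convex [f] and increasing nodes the two
    descriptions agree, because a chord lies above the graph between its nodes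
    and below it elsewhere ([chordedE]). *)
Definition chorded (R : realType) (f : R -> R) (s : nat -> R) (k : nat)
    (A : {set 'I_k}) (t : R) : R :=
  \big[Num.max/f t]_(j in A) chord f (s j) (s j.+1) t.

Lemma convex01_chorded (R : realType) (f : R -> R) (s : nat -> R) (k : nat)
    (A : {set 'I_k}) :
  convex01 f -> convex01 (chorded f s A).
Proof.
move=> /convex01P fc; apply/convex01P => p x y p01 x01 y01.
have /andP[p0 p1] := p01; have q0 : 0 <= 1 - p by rewrite subr_ge0.
apply: bigmax_le => [|j jA].
  by apply: le_trans (fc p x y p01 x01 y01) _; apply: lerD;
    apply: ler_wpM2l => //; exact: bigmax_ge_id.
have -> : chord f (s j) (s j.+1) (p * x + (1 - p) * y) =
    p * chord f (s j) (s j.+1) x + (1 - p) * chord f (s j) (s j.+1) y.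
  by rewrite /chord; ring.
by apply: lerD; apply: ler_wpM2l => //;
  exact: (le_bigmax_cond _ (fun j : 'I_k => chord f (s j) (s j.+1) _)).
Qed.

Lemma chordedE (R : realType) (f : R -> R) (s : nat -> R) (k : nat)
    (A : {set 'I_k}) (j : 'I_k) (t : R) :
  convex01 f -> {homo s : i i' / (i < i')%N >-> i < i'} ->
  (forall i, (i <= k)%N -> 0 <= s i <= 1) -> s j <= t <= s j.+1 ->
  chorded f s A t = if j \in A then chord f (s j) (s j.+1) t else f t.
Proof.
move=> fc smono s01 /andP[sjt tsj].
have smono' : {homo s : i i' / (i <= i')%N >-> i <= i'}.
  by move=> i i'; rewrite leq_eqVlt => /predU1P[->//|/smono/ltW].
have [s0 s1] : 0 <= s j /\ s j.+1 <= 1.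
  by have /andP[? _] := s01 j (ltnW (ltn_ord j));
    have /andP[_ ?] := s01 j.+1 (ltn_ord j).
have out i : i != j -> chord f (s i) (s i.+1) t <= f t.
  move=> ij; have /andP[? _] := s01 i (ltnW (ltn_ord i)).
  have /andP[_ ?] := s01 i.+1 (ltn_ord i).
  apply: chord_le_outside => //; [exact: smono | lra|].
  have [jlti|iltj|ji] := ltngtP j i.
  - by left; apply: le_trans tsj (smono' _ _ jlti).
  - by right; apply: le_trans (smono' _ _ iltj) sjt.
  - by rewrite -(val_inj ji) eqxx in ij.
apply/le_anti/andP; split.
- apply: bigmax_le => [|i iA].
    by case: ifP => // _; apply: chord_ge_inside; rewrite ?smono ?sjt.
  have [<-|ij] := eqVneq i j; first by rewrite iA.
  apply: le_trans (out i ij) _; case: ifP => // _.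
  by apply: chord_ge_inside; rewrite ?smono ?sjt.
- case: ifPn => [jA|_]; last exact: bigmax_ge_id.
  exact: (le_bigmax_cond _ (fun j : 'I_k => chord f (s j) (s j.+1) t)).
Qed.

(** * Design points in a subinterval *)

(** The sequence climbs by at most [d] at each step, so advancing from [u] to [v]
    takes at most one step more than the number of its visits to [[u, v]]. *)
Lemma interval_le_count (R : realType) (X : nat -> R) (m : nat) (d u v : R) :
  0 <= d -> X 0%N - u <= d -> v - X m <= d ->
  (forall i, (i < m)%N -> X i.+1 - X i <= d) ->
  v - u <= d * (1 + (\sum_(i < m.+1) (u <= X i <= v)%R)%:R).
Proof.
move=> d0 X0 Xm gap.
(* The minimum with [v] freezes the progress once [X] has passed [v]. *)
have P i : (i <= m)%N ->
    Num.min (X i) v - u <= d * (1 + (\sum_(j < i) (u <= X j <= v)%R)%:R).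
  elim: i => [_|i IH im].
    by rewrite big_ord0 addr0 mulr1 (le_trans _ X0)// lerB// ge_min lexx.
  have {IH} := IH (ltnW im); rewrite big_ord_recr/=.
  set S := (\sum_(j < i) _)%N.
  have S0 : 0 <= d * S%:R :> R by rewrite mulr_ge0.
  have g := gap i im.
  have m1 : Num.min (X i.+1) v <= X i.+1 by rewrite ge_min lexx.
  have m2 : Num.min (X i.+1) v <= v by rewrite ge_min lexx orbT.
  case: (leP (X i) v) => [Xv|vX]; case: (leP u (X i)) => [uX|Xu];
    rewrite natrD mulrDr mulrDr/=; lra.
rewrite big_ord_recr/=; have := P m (leqnn m); set S := (\sum_(j < m) _)%N.
have S0 : 0 <= d * S%:R :> R by rewrite mulr_ge0.
by case: (leP (X m) v) => [Xv|vX]; case: (leP u (X m)) => [uX|Xu];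
    rewrite natrD mulrDr mulrDr/=; lra.
Qed.

(** An interval of length [l] in [[a, b]] contains at least [n * l / c2 - 1] design
    points.  At both ends of the design, [design_reaches] takes the place of the
    spacing bound, so intervals touching [a] or [b] lose no more than others. *)
Lemma design_count (R : realType) (n : nat) (c1 c2 : R) (x : 'I_n -> R)
    (a b u v : R) :
  (0 < n)%N -> 0 <= c2 -> design c1 c2 x -> design_reaches c2 x a b ->
  a <= u -> v <= b ->
  n%:R * (v - u) <= c2 * (1 + #|[set i | u <= x i <= v]%SET|%:R).
Proof.
case: n x => // n x _ c20 [x01 _ gap] reach au vb.
have n0 : 0 < n.+1%:R :> R by rewrite ltr0n.
have := @interval_le_count R (fun i => x (inord i)) n (c2 / n.+1%:R) u v.
have -> : (\sum_(i < n.+1) (u <= x (inord i) <= v)%R)%N =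
    #|[set i | u <= x i <= v]%SET|.
  rewrite -sum1_card [RHS]big_mkcond/=. apply: eq_bigr => i _.
  by rewrite inE inord_val; case: ifP.
rewrite -ler_pdivlMl// mulrA [_^-1 * _]mulrC; apply.
- by rewrite divr_ge0.
- rewrite ler_pdivlMr// mulrC; have [/(_ (inordK _))] := reach (inord 0).
  by move=> /(_ isT) x0 _; apply: le_trans x0; rewrite ler_pM2l// lerB.
- rewrite ler_pdivlMr// mulrC; have [_] := reach (inord n).
  by rewrite inordK// => /(_ erefl); apply: le_trans; rewrite ler_pM2l// lerB.
- move=> i im; rewrite ler_pdivlMr// mulrC.
  by have /andP[] := gap (inord i) (inord i.+1)
    ltac:(by rewrite !inordK// ltnS ltnW).
Qed.

(** * Covering the cube of subsets *)

Definition symdiff (T : finType) (A B : {set T}) : {set T} :=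
  [set i | (i \in A) != (i \in B)]%SET.

(** Give each pair of subsets the weight [2] to the number of points where they
    agree.  The weights of all pairs with a fixed second member sum to
    [3 ^ #|T|], as the sum factors over the points of [T], while two members of
    a fibre of [F] have weight at least [2 ^ #|T| / 2 ^ D]; so a fibre has at
    most [2 ^ D * 3 ^ #|T| / 2 ^ #|T|] members.  The bound is useful for [D] a
    small fraction of [#|T|]. *)
Lemma card_cube_le (T I : finType) (F : {set T} -> I) (D : nat) :
  (forall A B, F A = F B -> (#|symdiff A B| <= D)%N) ->
  (4 ^ #|T| <= #|I| * 2 ^ D * 3 ^ #|T|)%N.
Proof.
move=> diam.
pose w (A B : {set T}) := (2 ^ #|~: symdiff A B|)%N.
have sumw B : (\sum_A w A B = 3 ^ #|T|)%N.
  rewrite -[RHS]prod_nat_const.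
  transitivity (\prod_(i : T) ((if i \in B then 2 else 1) +
                               (if i \in B then 1 else 2)))%N; last first.
    by apply: eq_bigr => i _; case: ifP.
  rewrite bigA_distr/=; apply: eq_bigr => A _.
  rewrite /w -prod_nat_const big_mkcond/=; apply: eq_bigr => i _.
  by rewrite !inE negbK; case: (i \in A); case: (i \in B).
have w_ge A B : F A = F B -> (2 ^ #|T| <= 2 ^ D * w A B)%N.
  move=> /diam AB; rewrite /w -expnD leq_exp2l// -(cardsC (symdiff A B)).
  by rewrite leq_add2r.
have fibre c : (#|[set A | F A == c]%SET| * 2 ^ #|T| <= 2 ^ D * 3 ^ #|T|)%N.
  have [->|[B]] := set_0Vmem [set A | F A == c]%SET; first by rewrite cards0.
  rewrite inE => /eqP FB.
  rewrite -sum_nat_const -(sumw B) big_distrr/=.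
  rewrite [leqRHS](bigID (mem [set A | F A == c]%SET))/=.
  apply: leq_trans (leq_addr _ _).
  by apply: leq_sum => A; rewrite inE => /eqP FA; apply: w_ge; rewrite FA FB.
have -> : (4 ^ #|T| = \sum_c #|[set A | F A == c]%SET| * 2 ^ #|T|)%N.
  rewrite -big_distrl/= (_ : 4 = 2 * 2)%N// expnMn; congr (_ * _)%N.
  rewrite -[in LHS]cardsT -card_powerset powersetT cardsT.
  rewrite -sum1_card (partition_big F predT)//=.
  by apply: eq_bigr => c _; rewrite -sum1_card; apply: eq_bigl => A; rewrite inE.
rewrite -mulnA -sum_nat_const; apply: leq_sum => c _; exact: fibre.
Qed.

(** Two functions in the same ball satisfy [ell2 <= 4 * e ^+ 2] by the inequality
    [(p - q)^2 <= 2 (p - y)^2 + 2 (q - y)^2], summed over the design points.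
    Sending each subset to the ball that contains its function puts us in the
    situation of [card_cube_le]. *)
Lemma coverable_cube (R : realType) (n : nat) (x : 'I_n -> R) (e : R)
    (F : set (R -> R)) (N k D : nat) (phi : {set 'I_k} -> R -> R) :
  0 <= e -> coverable (ell x) e F N -> (forall A, F (phi A)) ->
  (forall A B, ell2 x (phi A) (phi B) <= 4 * e ^+ 2 ->
     (#|symdiff A B| <= D)%N) ->
  (4 ^ k <= N * 2 ^ D * 3 ^ k)%N.
Proof.
move=> e0 [z cov] Fphi diam.
have ell2_ge0 g h : 0 <= ell2 x g h.
  by rewrite mulr_ge0 ?invr_ge0// sumr_ge0// => i _; exact: sqr_ge0.
have /choice[c cP] : forall A, exists c : 'I_N, ell2 x (phi A) (z c) <= e ^+ 2.
  move=> A; have [c _ /= Ac] := cov _ (Fphi A); exists c.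
  rewrite -(sqr_sqrtr (ell2_ge0 _ _)) lerXn2r// nnegrE; exact: sqrtr_ge0.
rewrite -[k]card_ord -[N]card_ord.
apply: (@card_cube_le _ _ c) => A B cAB; apply: diam.
have half : ell2 x (phi A) (phi B) <=
    2 * (ell2 x (phi A) (z (c A)) + ell2 x (phi B) (z (c A))).
  rewrite /ell2 -mulrDr mulrCA -big_split/= ler_wpM2l ?invr_ge0//.
  rewrite mulr_sumr; apply: ler_sum => i _.
  set p := phi A _; set q := phi B _; set y := z _ _.
  have := sqr_ge0 (p + q - 2 * y); lra.
apply: (le_trans half); have := cP A; have := cP B; rewrite -cAB; lra.
Qed.

(** * Distances between chorded functions *)

Section Separation.
Variables (R : realType) (a b k1 k2 c1 c2 eta : R) (n k : nat).
Variables (x : 'I_n -> R) (f : R -> R).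
Hypotheses (a0 : 0 <= a) (b1 : b <= 1) (k10 : 0 < k1) (k20 : 0 < k2)
  (n0 : (0 < n)%N) (eta0 : 0 < eta) (ketab : a + k%:R * eta <= b)
  (fcurved : f \in curved a b k1 k2) (xdesign : design c1 c2 x).

Let s (j : nat) : R := a + j%:R * eta.

Let sS j : s j.+1 = s j + eta.
Proof. by rewrite /s -natr1 mulrDl mul1r addrA. Qed.

Let s_lt : {homo s : i j / (i < j)%N >-> i < j}.
Proof. by move=> i j ij; rewrite /s ltrD2l ltr_pM2r// ltr_nat. Qed.

Let s_le : {homo s : i j / (i <= j)%N >-> i <= j}.
Proof. by move=> i j; rewrite leq_eqVlt => /predU1P[->//|/s_lt/ltW]. Qed.

Let s_ab j : (j <= k)%N -> a <= s j <= b.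
Proof.
move=> jk; rewrite (le_trans (s_le jk))// andbT.
by rewrite /s lerDl mulr_ge0// ltW.
Qed.

Let s_01 j : (j <= k)%N -> 0 <= s j <= 1.
Proof.
by move=> /s_ab/andP[asj sjb]; rewrite (le_trans a0 asj) (le_trans sjb b1).
Qed.

Let fconvex : convex01 f.
Proof. by move: fcurved; rewrite inE => -[]. Qed.

(** [k2 / 8 * eta ^+ 2] is the maximum of [k2 / 2 * (t - u) * (v - t)] over an
    interval [[u, v]] of length [eta]. *)
Lemma ell2_chorded_le (A : {set 'I_k}) :
  ell2 x (chorded f s A) f <= (k2 / 8 * eta ^+ 2) ^+ 2.
Proof.
have n0' : 0 < n%:R :> R by rewrite ltr0n.
rewrite /ell2 mulrC ler_pdivrMr//.
have -> : (k2 / 8 * eta ^+ 2) ^+ 2 * n%:R =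
    \sum_(i < n) (k2 / 8 * eta ^+ 2) ^+ 2.
  by rewrite sumr_const card_ord mulr_natr.
apply: ler_sum => i _; have [/(_ i) x01 _ _] := xdesign.
have w0 : 0 <= k2 / 8 * eta ^+ 2 by rewrite mulr_ge0 ?divr_ge0 ?sqr_ge0// ltW.
rewrite ler_sqr ?nnegrE// ?subr_ge0; last exact: bigmax_ge_id.
rewrite lerBlDr; apply: bigmax_le => [|j _]; first by rewrite lerDr.
have jk := ltn_ord j.
have /andP[asj _] := s_ab (ltnW jk); have /andP[_ sjb] := s_ab jk.
have sj := s_lt (ltnSn j).
have [/andP[sx xs]|out] := boolP (s j <= x i <= s j.+1).
- have in_j : s j <= x i <= s j.+1 by rewrite sx.
  have /andP[_] := chord_bounds fcurved asj sj sjb in_j.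
  rewrite -lerBlDr => /le_trans; apply.
  rewrite sS; set y := x i - s j.
  have -> : s j + eta - x i = eta - y by rewrite /y; ring.
  have -> : k2 / 8 * eta ^+ 2 = k2 / 2 * (eta ^+ 2 / 4) by field.
  rewrite ler_pM2l ?divr_gt0//; have := sqr_ge0 (eta - 2 * y); lra.
- apply: (@le_trans _ _ (f (x i))); last by rewrite lerDr.
  apply: (chord_le_outside fconvex (le_trans a0 asj) sj (le_trans sjb b1) x01).
  have [xs|sx] := leP (x i) (s j); first by left.
  by right; move: out; rewrite (ltW sx)/= -ltNge => /ltW.
Qed.

(** On the middle half of an interval, [k1 / 2 * (t - u) * (v - t)] is at least
    [3 * k1 / 32 * eta ^+ 2].  That half contains at least
    [n * (eta / 2) / c2 - 1 >= n * eta / (4 * c2)] design points, and the factor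
    [1 / n] in [ell2] cancels the [n]. *)
Lemma ell2_chorded_ge (A B : {set 'I_k}) :
  0 < c2 -> design_reaches c2 x a b -> 4 * c2 <= n%:R * eta ->
  #|symdiff A B|%:R * (9 * k1 ^+ 2 / (64 ^+ 2 * c2) * eta ^+ 5) <=
    ell2 x (chorded f s A) (chorded f s B).
Proof.
move=> c20 reach neta; have eta_gt0 := eta0.
have n0' : 0 < n%:R :> R by rewrite ltr0n.
pose P (j : 'I_k) : {set 'I_n} :=
  [set i | s j + eta / 4 <= x i <= s j + 3 * eta / 4]%SET.
pose g i := (chorded f s A (x i) - chorded f s B (x i)) ^+ 2.
have g0 i : 0 <= g i by exact: sqr_ge0.
have P_inj i j j' : i \in P j -> i \in P j' -> j = j'.
  have lt_out (l l' : 'I_k) : (l < l')%N -> i \in P l -> i \in P l' -> False.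
    move=> /s_le; rewrite sS !inE => sll' /andP[_ xl] /andP[xl' _].
    lra.
  move=> ij ij'; apply/val_inj; have [jj'|jj'|//] := ltngtP j j'.
  - by case: (lt_out _ _ jj' ij ij').
  - by case: (lt_out _ _ jj' ij' ij).
have cardP j : n%:R * eta / (4 * c2) <= #|P j|%:R.
  have jk := ltn_ord j.
  have /andP[asj _] := s_ab (ltnW jk).
  have /andP[_] := s_ab jk; rewrite sS => sjb.
  have := @design_count _ _ _ _ _ _ _ (s j + eta / 4) (s j + 3 * eta / 4)
    n0 (ltW c20) xdesign reach.
  rewrite -/(P j) ler_pdivrMr ?mulr_gt0// => count.
  have {count} : n%:R * (s j + 3 * eta / 4 - (s j + eta / 4)) <=
      c2 * (1 + #|P j|%:R) by apply: count; lra.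
  have -> : s j + 3 * eta / 4 - (s j + eta / 4) = eta / 2 by field.
  lra.
have gP j i : j \in symdiff A B -> i \in P j ->
    (3 * k1 / 32 * eta ^+ 2) ^+ 2 <= g i.
  rewrite !inE => jAB /andP[sx xs]; have jk := ltn_ord j.
  have /andP[asj _] := s_ab (ltnW jk); have /andP[_ sjb] := s_ab jk.
  have in_j : s j <= x i <= s j.+1 by rewrite sS; apply/andP; split; lra.
  have /andP[lower _] := chord_bounds fcurved asj (s_lt (ltnSn j)) sjb in_j.
  have {}lower : 3 * k1 / 32 * eta ^+ 2 <= chord f (s j) (s j.+1) (x i) - f (x i).
    apply: le_trans lower.
    have -> : 3 * k1 / 32 * eta ^+ 2 = k1 / 2 * (3 / 16 * eta ^+ 2) by field.
    rewrite ler_pM2l ?divr_gt0// sS; set y := x i - s j.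
    have -> : s j + eta - x i = eta - y by rewrite /y; ring.
    have : 0 <= (y - eta / 4) * (3 * eta / 4 - y).
      by apply: mulr_ge0; rewrite /y; lra.
    lra.
  have w0 : 0 <= 3 * k1 / 32 * eta ^+ 2.
    by rewrite mulr_ge0 ?divr_ge0 ?sqr_ge0// mulr_ge0// ltW.
  have sq : (3 * k1 / 32 * eta ^+ 2) ^+ 2 <=
      (chord f (s j) (s j.+1) (x i) - f (x i)) ^+ 2.
    by rewrite ler_sqr ?nnegrE// (le_trans w0).
  rewrite /g !(chordedE _ fconvex s_lt s_01 in_j).
  by move: jAB; case: (j \in A); case: (j \in B) => //= _;
    rewrite // -[leRHS]sqrrN opprB.
(* Only the design points in some middle half are kept; each is in at most one. *)
rewrite /ell2 [leRHS]mulrC ler_pdivlMr//.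
apply: (@le_trans _ _
  (\sum_(i < n) \sum_(j in symdiff A B | i \in P j) g i)); last first.
  apply: ler_sum => i _; rewrite sumr_const -[leRHS]mulr1n ler_wpMn2l//.
  apply/card_le1_eqP => j j'; rewrite !unfold_in/= => /andP[_ ij] /andP[_ ij'].
  exact: P_inj ij' ij.
rewrite (exchange_big_dep (mem (symdiff A B)))/=; last by move=> i j _ /andP[].
have -> : #|symdiff A B|%:R * (9 * k1 ^+ 2 / (64 ^+ 2 * c2) * eta ^+ 5) * n%:R =
    \sum_(j in symdiff A B)
      n%:R * eta / (4 * c2) * (3 * k1 / 32 * eta ^+ 2) ^+ 2.
  rewrite sumr_const -[RHS]mulr_natl; field; lra.
apply: ler_sum => j jAB.
apply: (@le_trans _ _ (\sum_(i in P j) (3 * k1 / 32 * eta ^+ 2) ^+ 2)).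
  by rewrite sumr_const -[leRHS]mulr_natl ler_wpM2r// sqr_ge0.
rewrite [leRHS](eq_bigl (mem (P j))); last by move=> i /=; rewrite jAB.
by apply: ler_sum => i; exact: gP.
Qed.

End Separation.

(** * Lower bounds on covering numbers *)

Lemma lne_covering_ge (R : realType) (X : Type) (rho : X -> X -> R) (e y : R)
    (F : set X) :
  (forall N, coverable rho e F N -> expR y <= N%:R) ->
  (y%:E <= lne (covering_number e F rho))%E.
Proof.
move=> cov.
have H : ((expR y)%:E <= covering_number e F rho)%E.
  by apply: le_ereal_inf_tmp => _ [N /cov yN <-]; rewrite lee_fin.
rewrite -[y]expRK -lne_EFin ?expR_gt0// lee_lne// in_itv/= leey andbT.
  by rewrite lee_fin expR_ge0.
by apply: le_trans H; rewrite lee_fin expR_ge0.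
Qed.

(** Numerically, [4 * (2 * 3 ^ 8) <= 4 ^ 8]: with [8 * m] coordinates and families
    of diameter at most [m], the bound of [card_cube_le] is exponential. *)
Lemma expn4_le_cover (m N : nat) :
  (4 ^ (8 * m) <= N * 2 ^ m * 3 ^ (8 * m) -> 4 ^ m <= N)%N.
Proof.
rewrite !expnM -mulnA -expnMn => le.
have p : (0 < (2 * 3 ^ 8) ^ m)%N by rewrite expn_gt0.
rewrite -(leq_pmul2r p); apply: leq_trans le.
rewrite -expnMn; have [->//|m0] := posnP m.
by rewrite leq_exp2r.
Qed.

(** The functions [f + r] and [f - r] are convex, at distance [r] from [f] and
    [2 * r] from each other.  They are indexed by the cube of dimension one, for
    which [coverable_cube] with [D = 0] says [4 <= 3 * N]. *)
Lemma covering_ge2 (R : realType) (n : nat) (x : 'I_n -> R) (f : R -> R)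
    (r e : R) (N : nat) :
  (0 < n)%N -> convex01 f -> 0 <= e -> e < r ->
  coverable (ell x) e (convex_ball x f r) N -> (2 <= N)%N.
Proof.
move=> n0 /convex01P fc e0 er cov.
have n0' : n%:R != 0 :> R by rewrite pnatr_eq0 -lt0n.
have ell2_const (g h : R -> R) d :
    (forall i, (g (x i) - h (x i)) ^+ 2 = d) -> ell2 x g h = d.
  move=> gh; rewrite /ell2 (eq_bigr (fun=> d))//.
  by rewrite sumr_const card_ord -[X in _ * X]mulr_natl mulKf.
pose phi (A : {set 'I_1}) t := f t + (if ord0 \in A then r else - r).
suff : (4 ^ 1 <= N * 2 ^ 0 * 3 ^ 1)%N by lia.
apply: (@coverable_cube _ _ x e _ _ _ _ phi e0 cov) => [A|A B].
- split; last first.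
    by rewrite (ell2_const _ _ (r ^+ 2))// => i;
      rewrite /phi; case: ifP => _; ring.
  apply/convex01P => p u v p01 u01 v01; have := fc p u v p01 u01 v01.
  rewrite /phi; lra.
- have [AB|AB] := eqVneq (ord0 \in A) (ord0 \in B).
    move=> _; rewrite leqn0 cards_eq0; apply/eqP/setP => i.
    by rewrite !inE (ord1 i) AB eqxx.
  rewrite (ell2_const _ _ (4 * r ^+ 2)) ?ler_pM2l// ?ler_sqr ?nnegrE//; try lra.
  move=> i; rewrite /phi; move: AB.
  by case: (ord0 \in A); case: (ord0 \in B) => //= _; ring.
Qed.

Lemma expR_half_le2 (R : realType) : expR (2^-1 : R) <= 2.
Proof.
have := @expR_ge1Dx R (- 2^-1); rewrite expRN => h.
rewrite -lef_pV2 ?posrE ?expR_gt0//; apply: le_trans h; lra.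
Qed.

(** * The entropy bound *)

Theorem theorem3p2 (R : realType) (k1 k2 L c2 : R) :
  0 < k1 -> k1 < k2 -> 0 < L -> 0 < c2 ->
  exists c eps0 eps1 : R,
    [/\ 0 < c, 0 < eps0 & 0 < eps1] /\
    forall (n : nat) (c1 : R) (x : 'I_n -> R) (a b : R) (phi0 : R -> R)
           (r eps : R),
      (2 <= n)%N -> 0 < c1 -> design c1 c2 x ->
      0 <= a -> b <= 1 -> b - a = L -> design_reaches c2 x a b ->
      phi0 \in curved a b k1 k2 ->
      0 < r ->
      eps1 * n%:R ^- 2 <= eps <= r * eps0 ->
      ((c * eps `^ (- 2^-1))%:E
         <= lne (covering_number eps (convex_ball x phi0 r) (ell x)))%E.
Proof.
move=> k10 k12 L0 c20; have k20 := lt_trans k10 k12.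
(* [W * eta ^+ 5] is the contribution of one interval in [ell2_chorded_ge]. *)
pose W := 9 * k1 ^+ 2 / (64 ^+ 2 * c2).
have W0 : 0 < W by apply: divr_gt0; rewrite mulr_gt0 ?exprn_gt0.
(* [Q] bounds the ratio of [m] to [eps `^ (- 2^-1)], where [8 * m] intervals are
   used.  Its value makes [m * (W * eta ^+ 5)] at least [4 * eps ^+ 2], so that
   subsets whose functions lie in one ball differ on at most [m] intervals. *)
pose Q4 := W * L ^+ 5 / (4 * 8 ^+ 5).
have Q40 : 0 < Q4 by apply: divr_gt0; rewrite mulr_gt0 ?exprn_gt0.
pose Q := Num.sqrt (Num.sqrt Q4).
have Q0 : 0 < Q by rewrite /Q !sqrtr_gt0.
have QE : Q ^+ 4 = Q4.
  by rewrite (exprM Q 2 2) sqr_sqrtr ?sqrtr_ge0// sqr_sqrtr// ltW.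
(* [e0] serves both constructions: [eps < r] for the pair of translates, and
   perturbations of size at most [r] for the chords. *)
pose e0 := Num.min 2^-1 (128 * Q ^+ 2 / (k2 * L ^+ 2)).
(* [e1] makes [n * eta] at least [4 * c2]. *)
pose e1 := (32 * c2 * Q / L) ^+ 2.
exists (Q / 2), e0, e1; split.
  split; first by rewrite divr_gt0.
  - by rewrite lt_min invr_gt0 ltr0n/= divr_gt0 ?mulr_gt0 ?exprn_gt0.
  - by rewrite exprn_gt0// divr_gt0// !mulr_gt0.
move=> n c1 x a b f r eps n2 c10 xdesign age0 ble1 abL reach fcurved r0.
move=> /andP[eps_ge eps_le].
have n0 : (0 < n)%N by exact: leq_trans n2.
have n0' : 0 < n%:R :> R by rewrite ltr0n.
have fconvex : convex01 f by move: fcurved; rewrite inE => -[].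
have epsr : 2 * eps <= r.
  have : eps <= r * 2^-1 by rewrite (le_trans eps_le)// ler_pM2l// ge_min lexx.
  lra.
have eps_k2 : eps * (k2 * L ^+ 2) <= r * (128 * Q ^+ 2).
  rewrite -ler_pdivlMr ?mulr_gt0 ?exprn_gt0// (le_trans eps_le)//.
  by rewrite -mulrA ler_pM2l// ge_min lexx orbT.
have eps_gt0 : 0 < eps.
  apply: lt_le_trans eps_ge.
  by rewrite divr_gt0 ?exprn_gt0// divr_gt0// !mulr_gt0.
pose q := Num.sqrt eps.
have q0 : 0 < q by rewrite /q sqrtr_gt0.
have qE : q ^+ 2 = eps by rewrite sqr_sqrtr// ltW.
have q_ge : 32 * c2 * Q / L <= n%:R * q.
  have l0 : 0 <= 32 * c2 * Q / L by rewrite divr_ge0 ?mulr_ge0// ltW.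
  have r0' : 0 <= n%:R * q by rewrite mulr_ge0// ltW.
  by rewrite -ler_sqr ?nnegrE// [leRHS]exprMn qE -ler_pdivrMl ?exprn_gt0// mulrC.
rewrite powRN powR12_sqrt ?(ltW eps_gt0)// -/q.
apply: lne_covering_ge => N cov.
(* For [q > Q] the exponent is below [1 / 2], and two balls suffice. *)
have [qQ|Qq] := leP q Q; last first.
  have N2 : (2 <= N)%N by apply: covering_ge2 cov => //; lra.
  have N2' : 2 <= N%:R :> R by rewrite ler_nat.
  apply: le_trans N2'.
  have half : Q / 2 / q <= 2^-1 by rewrite ler_pdivrMr//; lra.
  rewrite (le_trans (_ : _ <= expR (2^-1)))// ?ler_expR//.
  exact: expR_half_le2.
pose m := Num.trunc (Q / q).
have m_gt0 : (0 < m)%N by rewrite truncn_gt0 ler_pdivlMr// mul1r.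
have m0 : 0 < m%:R :> R by rewrite ltr0n.
have m1 : 1 <= m%:R :> R by rewrite (ler_nat _ 1).
have /andP[mQ Qm] : m%:R <= Q / q < m.+1%:R.
  by apply: truncn_itv; rewrite divr_ge0// ltW.
have {mQ}mQ : m%:R * q <= Q by rewrite -ler_pdivlMr.
have {Qm}Qm : Q <= 2 * m%:R * q.
  rewrite -ler_pdivrMr// (le_trans (ltW Qm))// -natr1; lra.
pose eta := L / (8 * m%:R).
have eta0 : 0 < eta by rewrite divr_gt0// mulr_gt0.
have etaE : 8 * m%:R * eta = L by rewrite /eta; field; rewrite gt_eqF.
have eta_q : L * q <= 8 * Q * eta.
  rewrite /eta mulrA ler_pdivlMr ?mulr_gt0//.
  have : L * (m%:R * q) <= L * Q by rewrite ler_pM2l.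
  lra.
have eta_q' : 4 * Q * eta <= L * q.
  rewrite /eta mulrA ler_pdivrMr ?mulr_gt0//.
  have : L * Q <= L * (2 * m%:R * q) by rewrite ler_pM2l.
  lra.
(* From here on only these relations matter; the value of [eta] is hidden so that
   powers of [eta] are not expanded. *)
clearbody eta.
have neta : 4 * c2 <= n%:R * eta.
  have : 32 * c2 * Q <= n%:R * (L * q).
    by move: q_ge; rewrite ler_pdivrMr// => /le_trans; apply; lra.
  have : n%:R * (L * q) <= n%:R * (8 * Q * eta) by rewrite ler_pM2l.
  move=> h1 h2; rewrite -(ler_pM2l Q0); lra.
have ketab : a + (8 * m)%:R * eta <= b by rewrite natrM etaE; lra.
have chord_r : k2 / 8 * eta ^+ 2 <= r.
  have : (4 * Q * eta) ^+ 2 <= (L * q) ^+ 2.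
    by rewrite ler_sqr ?nnegrE// !mulr_ge0// ltW.
  rewrite !exprMn qE => h.
  have {}h := ler_wpM2l (ltW k20) h.
  rewrite -(ler_pM2r (_ : 0 < 128 * Q ^+ 2)); last by rewrite mulr_gt0 ?exprn_gt0.
  lra.
have cube : (4 ^ (8 * m) <= N * 2 ^ m * 3 ^ (8 * m))%N.
  apply: (@coverable_cube _ _ x eps _ _ _ _
    (fun A : {set 'I_(8 * m)} => chorded f (fun j => a + j%:R * eta) A)
    (ltW eps_gt0) cov) => [A|A B].
    split; first exact: convex01_chorded.
    apply: le_trans (ell2_chorded_le age0 ble1 k20 n0 eta0 ketab fcurved xdesign
      _) _.
    by rewrite ler_sqr ?nnegrE ?(ltW r0)// mulr_ge0 ?divr_ge0 ?sqr_ge0// ltW.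
  have := ell2_chorded_ge age0 ble1 k10 n0 eta0 ketab fcurved xdesign A B c20
    reach neta.
  rewrite -/W => sep near; rewrite -(ler_nat R).
  rewrite -(ler_pM2r (mulr_gt0 W0 (exprn_gt0 5 eta0))).
  apply: (le_trans sep); apply: (le_trans near).
  have : (L * q) ^+ 4 <= (8 * Q * eta) ^+ 4.
    by rewrite lerXn2r// nnegrE !mulr_ge0// ltW.
  rewrite !exprMn QE (exprM q 2 2) qE /Q4 => h.
  have L4 : 0 < L ^+ 4 by rewrite exprn_gt0.
  have -> : m%:R * (W * eta ^+ 5) = L * W * eta ^+ 4 / 8 by rewrite -etaE; field.
  rewrite -(ler_pM2l L4); lra.
have {cube} := expn4_le_cover cube; rewrite -(ler_nat R) natrX.
apply: le_trans; apply: (@le_trans _ _ (expR m%:R)).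
  by rewrite ler_expR ler_pdivrMr//; lra.
have -> : 4 = 2 ^+ 2 :> R by ring.
have -> : m%:R = m%:R * (2%:R * 2^-1) :> R by field.
rewrite !expRM_natl lerXn2r ?nnegrE ?exprn_ge0 ?expR_ge0//.
by rewrite lerXn2r ?nnegrE ?expR_ge0// expR_half_le2.
Qed.
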